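(* Let $H$ be a Hopf algebra over a field $\Bbbk$, let $A$ and $A'$ be partial $H$-module algebras with symmetrical partial actions, and let $(B,\theta)$, $(B',\theta')$ be globalizations for $A$ and $A'$ respectively. Assume that $r(A')=0$ or $l(A')=0$. If $(B,\theta)$ is a minimal globalization and $\alpha:A'\to A$ is a morphism of partial actions, then there exists a unique morphism of $H$-module algebras $\Phi:B'\to B$ such that $\Phi(\theta'(a))=\theta(\alpha(a))$ for each $a\in A'$.
   Context: Algebras are associative $\Bbbk$-algebras, not necessarily unital; $\Delta(h)=\sum h_{(1)}\otimes h_{(2)}$. $r(A)=\{a\in A: ba=0\ \forall b\in A\}$, $l(A)=\{b\in A: ba=0\ \forall a\in A\}$. A partial action of $H$ on $A$ is a linear map $\cdot:H\otimes A\to A$ with, for all $a,b\in A$, $h,k\in H$: $1_H\cdot a=a$ and $h\cdot(a(k\cdot b))=\sum(h_{(1)}\cdot a)(h_{(2)}k\cdot b)$; $A$ is then a partial $H$-module algebra. It is symmetrical if also $h\cdot((k\cdot b)a)=\sum(h_{(1)}k\cdot b)(h_{(2)}\cdot a)$. A morphism of partial actions is an algebra morphism $\alpha$ with $\alpha(h\cdot a)=h\cdot\alpha(a)$. A (possibly nonunital) $H$-module algebra is an algebra that is a left $H$-module via $\triangleright$ with $h\triangleright(bc)=\sum(h_{(1)}\triangleright b)(h_{(2)}\triangleright c)$; a morphism of $H$-module algebras is an $H$-linear (nonunital) algebra morphism. A globalization for a symmetrical partial action $\cdot$ on $A$ is a pair $(B,\theta)$ such that: (1) $B$ is a (possibly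 nonunital) $H$-module algebra with action $\triangleright$; (2) $\theta:A\to B$ is an injective algebra morphism; (3) $\theta((h\cdot a)b)=(h\triangleright\theta(a))\theta(b)$ and $\theta(b(h\cdot a))=\theta(b)(h\triangleright\theta(a))$ for all $a,b\in A$, $h\in H$; (4) $B=H\triangleright\theta(A)$ (the linear span of all $h\triangleright\theta(a)$); (5) $h\bullet\theta(a)=\theta(h\cdot a)$ defines a partial action of $H$ on $\theta(A)$. It is minimal if, for all finite families $h_i\in H$, $a_i\in A$, the condition $\sum_i kh_i\cdot a_i=0$ for all $k\in H$ implies $\sum_i h_i\triangleright\theta(a_i)=0$. *)

(* Defs.v *)
From HB Require Import structures.
From mathcomp Require Import all_boot all_order all_algebra.
From mathcomp Require Import generic_quotient.
From mathcomp Require Import boolp.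

Set Implicit Arguments.
Unset Strict Implicit.
Unset Printing Implicit Defensive.

Import GRing.Theory.

Local Open Scope ring_scope.
Local Open Scope quotient_scope.

Section TensorProduct.
Variables (K : fieldType) (U V : lmodType K).

(* Finite formal sums of pairs, identified when no bilinear map separates
   them: by the universal property this is equality in U (x) V. *)
Definition tens_eqv (s t : seq (U * V)) : bool :=
  `[< forall (W : lmodType K) (f : {bilinear U -> V -> W}),
        \sum_(p <- s) f p.1 p.2 = \sum_(p <- t) f p.1 p.2 >].

Lemma tens_eqv_equiv : equiv_class_of tens_eqv.
Proof.
split.
- by move=> s; apply/asboolP.
- by move=> s t; apply/asboolP/asboolP => st W f; rewrite st.
- by move=> t s u /asboolP st /asboolP tu; apply/asboolP => W f; rewrite st tu.
Qed.

Canonical tens_equiv := EquivRelPack tens_eqv_equiv.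

Definition tensor : Type := {eq_quot tens_equiv}.

HB.instance Definition _ := Choice.on tensor.
HB.instance Definition _ := Quotient.on tensor.
HB.instance Definition _ := EqQuotient.on tensor.

Definition tens (u : U) (v : V) : tensor := \pi_tensor [:: (u, v)].

(* The sum of the F u v over a representative of t: the value at t of the
   linear map induced by F when F is bilinear (tsum_tens, tsum_linear). *)
Definition tsum (W : lmodType K) (F : U -> V -> W) (t : tensor) : W :=
  \sum_(p <- repr t) F p.1 p.2.

Lemma tsum_pi (W : lmodType K) (f : {bilinear U -> V -> W}) s :
  tsum f (\pi_tensor s) = \sum_(p <- s) f p.1 p.2.
Proof.
have /eqmodP/asboolP E : repr (\pi_tensor s) = s %[mod tensor].
  by rewrite reprK.
exact: E.
Qed.

Lemma tensorP (s t : tensor) :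
  (forall (W : lmodType K) (f : {bilinear U -> V -> W}), tsum f s = tsum f t) ->
  s = t.
Proof.
by elim/quotW: s => s; elim/quotW: t => t st; apply/eqmodP/asboolP => W f;
  have := st W f; rewrite !tsum_pi.
Qed.

Definition tens0 : tensor := \pi_tensor [::].
Definition tens_add (s t : tensor) : tensor := \pi_tensor (repr s ++ repr t).
Definition tens_scale (c : K) (s : tensor) : tensor :=
  \pi_tensor [seq (c *: p.1, p.2) | p <- repr s].
Definition tens_opp := tens_scale (- 1).

Lemma tsum0 (W : lmodType K) (f : {bilinear U -> V -> W}) : tsum f tens0 = 0.
Proof. by rewrite tsum_pi big_nil. Qed.

Lemma tsumD (W : lmodType K) (f : {bilinear U -> V -> W}) s t :
  tsum f (tens_add s t) = tsum f s + tsum f t.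
Proof. by rewrite tsum_pi big_cat. Qed.

Lemma tsumZ (W : lmodType K) (f : {bilinear U -> V -> W}) c s :
  tsum f (tens_scale c s) = c *: tsum f s.
Proof.
rewrite tsum_pi big_map scaler_sumr; apply: eq_bigr => p _ /=.
by rewrite linearZl_LR.
Qed.

Lemma tens_addA : associative tens_add.
Proof. by move=> s t u; apply: tensorP => W f; rewrite !tsumD addrA. Qed.

Lemma tens_addC : commutative tens_add.
Proof. by move=> s t; apply: tensorP => W f; rewrite !tsumD addrC. Qed.

Lemma tens_add0 : left_id tens0 tens_add.
Proof. by move=> s; apply: tensorP => W f; rewrite tsumD tsum0 add0r. Qed.

Lemma tens_addN : left_inverse tens0 tens_opp tens_add.
Proof.
by move=> s; apply: tensorP => W f;
  rewrite tsumD tsumZ scaleN1r addNr tsum0.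
Qed.

HB.instance Definition _ :=
  GRing.isZmodule.Build tensor tens_addA tens_addC tens_add0 tens_addN.

Lemma tens_scaleA c d s : tens_scale c (tens_scale d s) = tens_scale (c * d) s.
Proof. by apply: tensorP => W f; rewrite !tsumZ scalerA. Qed.

Lemma tens_scale1 : left_id 1 tens_scale.
Proof. by move=> s; apply: tensorP => W f; rewrite tsumZ scale1r. Qed.

Lemma tens_scaleDr : right_distributive tens_scale +%R.
Proof.
by move=> c s t; apply: tensorP => W f; rewrite !(tsumZ, tsumD) scalerDr.
Qed.

Lemma tens_scaleDl s : {morph tens_scale^~ s : c d / c + d}.
Proof.
by move=> c d; apply: tensorP => W f; rewrite !(tsumZ, tsumD) scalerDl.
Qed.

HB.instance Definition _ := GRing.Zmodule_isLmodule.Build K tensor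
  tens_scaleA tens_scale1 tens_scaleDr tens_scaleDl.

Lemma tsum_linear (W : lmodType K) (f : {bilinear U -> V -> W}) :
  linear (tsum f).
Proof.
by move=> c s t; rewrite [c *: s + t]/(tens_add (tens_scale c s) t) tsumD tsumZ.
Qed.

Lemma tsum_tens (W : lmodType K) (f : {bilinear U -> V -> W}) u v :
  tsum f (tens u v) = f u v.
Proof. by rewrite tsum_pi big_seq1. Qed.

Lemma tens_bilinear : bilinear_for *:%R *:%R tens.
Proof.
split => [v c u u' | u c v v']; apply: tensorP => W f.
  by rewrite tsum_linear !tsum_tens linearPl.
by rewrite tsum_linear !tsum_tens linearPr.
Qed.

HB.instance Definition _ := bilinear_isBilinear.Build K U V tensor *:%R *:%R
  tens tens_bilinear.

Lemma tens_span (t : tensor) : t = tsum tens t.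
Proof.
elim/quotW: t => s; rewrite tsum_pi; apply: tensorP => W f.
elim: s => [|p s IHs]; first by rewrite big_nil tsum0.
rewrite big_cons -[X in tsum f (X + _)]scale1r tsum_linear -IHs scale1r tsum_tens !tsum_pi.
by rewrite big_cons.
Qed.

End TensorProduct.

Definition tmap (K : fieldType) (U U' V V' : lmodType K)
    (f : U -> U') (g : V -> V') : tensor U V -> tensor U' V' :=
  tsum (fun u v => tens (f u) (g v)).

Definition tassoc (K : fieldType) (U V W : lmodType K) :
    tensor (tensor U V) W -> tensor U (tensor V W) :=
  tsum (fun s w => tsum (fun u v => tens u (tens v w)) s).

(* (a (x) b)(a' (x) b') = aa' (x) bb', extended bilinearly. *)
Definition tmul (K : fieldType) (A : algType K) (s t : tensor A A) :
    tensor A A :=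
  tsum (fun a b => tsum (fun a' b' => tens (a * a') (b * b')) t) s.

HB.mixin Record Lmodule_isCoalgebra (K : fieldType) C of GRing.Lmodule K C := {
  coprod : {linear C -> tensor C C};
  counit : {scalar C};
  coprodA : forall c : C,
    tassoc (tmap coprod idfun (coprod c)) = tmap idfun coprod (coprod c);
  counitl : forall c : C, tsum (fun x y : C => counit x *: y) (coprod c) = c;
  counitr : forall c : C, tsum (fun x y : C => counit y *: x) (coprod c) = c
}.

#[short(type="coalgType")]
HB.structure Definition Coalgebra (K : fieldType) :=
  {C of Lmodule_isCoalgebra K C & GRing.Lmodule K C}.

HB.mixin Record Coalgebra_isHopf (K : fieldType) H
    of GRing.Algebra K H & Coalgebra K H := {
  coprod1 : coprod (1 : H) = tens 1 1;
  coprodM : forall h k : H, coprod (h * k) = tmul (coprod h) (coprod k);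
  counit1 : counit (1 : H) = 1;
  counitM : forall h k : H, counit (h * k) = counit h * counit k;
  antipode : {linear H -> H};
  antipodel : forall h : H,
    tsum (fun x y : H => antipode x * y) (coprod h) = (counit h)%:A;
  antipoder : forall h : H,
    tsum (fun x y : H => x * antipode y) (coprod h) = (counit h)%:A
}.

#[short(type="hopfAlgType")]
HB.structure Definition HopfAlgebra (K : fieldType) :=
  {H of Coalgebra_isHopf K H & GRing.Algebra K H & Coalgebra K H}.

(* sweedler h F is the Sweedler sum of F h_(1) h_(2), for F bilinear. *)
Definition sweedler (K : fieldType) (C : coalgType K) (W : lmodType K) (h : C)
    (F : C -> C -> W) : W :=
  tsum F (coprod h).

(* NU stands for not necessarily unital. *)
HB.mixin Record Lmodule_isNUAlgebra (K : fieldType) A of GRing.Lmodule K A := {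
  numul : {bilinear A -> A -> A};
  numulA : associative numul
}.

#[short(type="nuAlgType")]
HB.structure Definition NUAlgebra (K : fieldType) :=
  {A of Lmodule_isNUAlgebra K A & GRing.Lmodule K A}.

Notation "a ** b" := (numul a b) (at level 40, left associativity) : ring_scope.

HB.mixin Record isNUMultiplicative (K : fieldType) (A B : nuAlgType K)
    (f : A -> B) := {
  numorphM : {morph f : a b / a ** b}
}.

HB.structure Definition NUMorphism (K : fieldType) (A B : nuAlgType K) :=
  {f of isNUMultiplicative K A B f & @GRing.Linear K A B *:%R f}.

Notation "{ 'numorphism' A -> B }" := (NUMorphism.type A%type B%type)
  (at level 0, A at level 98, B at level 99,
   format "{ 'numorphism'  A  ->  B }") : type_scope.

Definition rann (K : fieldType) (A : nuAlgType K) (a : A) : Prop :=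
  forall b : A, b ** a = 0.
Definition lann (K : fieldType) (A : nuAlgType K) (b : A) : Prop :=
  forall a : A, b ** a = 0.

Section Image.
Variables (K : fieldType) (A B : nuAlgType K) (f : {numorphism A -> B}).

Definition img_pred : {pred B} := fun b => `[< exists a, f a = b >].

Record imgalg := ImgAlg { imgval : B; _ : imgval \in img_pred }.

HB.instance Definition _ := [isSub for imgval].
HB.instance Definition _ := [Choice of imgalg by <:].

Lemma img_submod_closed : submod_closed img_pred.
Proof.
split; first by apply/asboolP; exists 0; rewrite linear0.
move=> c _ _ /asboolP[a <-] /asboolP[b <-].
by apply/asboolP; exists (c *: a + b); rewrite linearP.
Qed.

HB.instance Definition _ := GRing.isSubmodClosed.Build K B img_pred
  img_submod_closed.
HB.instance Definition _ := [SubChoice_isSubLmodule of imgalg by <:].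

Lemma img_mul_subproof (x y : imgalg) : val x ** val y \in img_pred.
Proof.
case: x y => [_ /= /asboolP[a <-]] [_ /= /asboolP[b <-]].
by apply/asboolP; exists (a ** b); rewrite numorphM.
Qed.

Definition img_mul (x y : imgalg) : imgalg := ImgAlg (img_mul_subproof x y).

Lemma img_mul_bilinear : bilinear_for *:%R *:%R img_mul.
Proof.
split=> [y c x x' | x c y y']; apply: val_inj => /=;
  by rewrite !(linearP, linearPl, linearPr).
Qed.

HB.instance Definition _ := bilinear_isBilinear.Build K imgalg imgalg imgalg
  *:%R *:%R img_mul img_mul_bilinear.

Lemma img_mulA : associative img_mul.
Proof. by move=> x y z; apply: val_inj; rewrite /= numulA. Qed.

HB.instance Definition _ := Lmodule_isNUAlgebra.Build K imgalg img_mulA.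

Lemma to_img_subproof a : f a \in img_pred.
Proof. by apply/asboolP; exists a. Qed.

Definition to_img (a : A) : imgalg := ImgAlg (to_img_subproof a).

End Image.

Section Actions.
Variables (K : fieldType) (H : hopfAlgType K).

Section Partial.
Variables (A : nuAlgType K) (act : {bilinear H -> A -> A}).

Definition partial_action : Prop :=
  (forall a, act 1 a = a) /\
  (forall h k a b, act h (a ** act k b) =
     sweedler h (fun h1 h2 => act h1 a ** act (h2 * k) b)).

Definition symmetrical_partial_action : Prop :=
  partial_action /\
  (forall h k a b, act h (act k b ** a) =
     sweedler h (fun h1 h2 => act (h1 * k) b ** act h2 a)).

End Partial.

Definition partial_action_morphism (A' A : nuAlgType K)
    (act' : {bilinear H -> A' -> A'}) (act : {bilinear H -> A -> A})
    (alpha : {numorphism A' -> A}) : Prop :=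
  forall h a, alpha (act' h a) = act h (alpha a).

Definition module_algebra (B : nuAlgType K) (tr : {bilinear H -> B -> B}) :
    Prop :=
  [/\ forall b, tr 1 b = b,
      forall h k b, tr (h * k) b = tr h (tr k b) &
      forall h b c, tr h (b ** c) =
        sweedler h (fun h1 h2 => tr h1 b ** tr h2 c)].

Definition module_algebra_morphism (B' B : nuAlgType K)
    (tr' : {bilinear H -> B' -> B'}) (tr : {bilinear H -> B -> B})
    (Phi : B' -> B) : Prop :=
  [/\ linear Phi,
      {morph Phi : b c / b ** c} &
      forall h b, Phi (tr' h b) = tr h (Phi b)].

Section Globalization.
Variables (A B : nuAlgType K).
Variables (act : {bilinear H -> A -> A}) (tr : {bilinear H -> B -> B}).
Variable theta : {numorphism A -> B}.

Record globalization : Prop := Globalization {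
  glob_modalg : module_algebra tr;
  glob_inj : injective theta;
  glob_mull : forall h a b, theta (act h a ** b) = tr h (theta a) ** theta b;
  glob_mulr : forall h a b, theta (b ** act h a) = theta b ** tr h (theta a);
  glob_span : forall b, exists n (c : 'I_n -> K) (h : 'I_n -> H) (a : 'I_n -> A),
    b = \sum_i c i *: tr (h i) (theta (a i));
  glob_partial : exists bul : {bilinear H -> imgalg theta -> imgalg theta},
    (forall h a, bul h (to_img theta a) = to_img theta (act h a)) /\
    partial_action bul
}.

Definition minimal_globalization : Prop :=
  globalization /\
  forall n (h : 'I_n -> H) (a : 'I_n -> A),
    (forall k : H, \sum_i act (k * h i) (a i) = 0) ->
    \sum_i tr (h i) (theta (a i)) = 0.

End Globalization.
End Actions.

(* Main.v *)
(** A minimal globalization detects zero on [A]: [\sum_i h_i |> theta (a_i)]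
    vanishes as soon as all [\sum_i k h_i . a_i] do. Conversely a relation
    [\sum_i h_i |> theta' (a_i) = 0] in [B'], acted on by [k] and multiplied on
    either side by [theta' b], shows that [\sum_i k h_i . a_i] annihilates [A']
    on both sides, hence is [0]. So [h |> theta' a |-> h |> theta (alpha a)] is
    well defined; it is multiplicative because
    [(h |> x) (k |> y) = \sum h_(1) |> (x (S h_(2) k |> y))] expresses products
    in a globalization through the partial action alone. *)
Require Import Defs.
From HB Require Import structures.
From mathcomp Require Import all_boot all_order all_algebra.
From mathcomp Require Import boolp.

Set Implicit Arguments.
Unset Strict Implicit.
Unset Printing Implicit Defensive.

Import GRing.Theory.
Local Open Scope ring_scope.

Section TensorSums.
Variables (K : fieldType) (U V W : lmodType K) (F : U -> V -> W).
Hypothesis F_bilinear : bilinear_for *:%R *:%R F.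

Let f : {bilinear U -> V -> W} :=
  HB.pack F (bilinear_isBilinear.Build K U V W *:%R *:%R F F_bilinear).

(** Unbundled forms of [tsum_tens] and [tsum_linear], for integrands that are anonymous functions
    without a packed bilinear structure. *)
Lemma tsum_bilinear_tens u v : tsum F (tens u v) = F u v.
Proof. exact: (tsum_tens f). Qed.

Lemma tsum_bilinear_linear : linear (tsum F).
Proof. exact: (tsum_linear f). Qed.

End TensorSums.

Lemma eq_tsum (K : fieldType) (U V W : lmodType K) (F G : U -> V -> W)
    (t : tensor U V) :
  (forall u v, F u v = G u v) -> tsum F t = tsum G t.
Proof. by move=> FG; apply: eq_bigr. Qed.

Lemma linear_big (K : fieldType) (U V : lmodType K) (f : U -> V) (I : Type)
    (s : seq I) (E : I -> U) :
  linear f -> f (\sum_(i <- s) E i) = \sum_(i <- s) f (E i).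
Proof.
move=> f_linear.
exact: (linear_sum (HB.pack_for {linear U -> V} f
  (GRing.isLinear.Build K U V *:%R f f_linear))).
Qed.

Lemma linear_tsum (K : fieldType) (U V W X : lmodType K) (g : W -> X)
    (F : U -> V -> W) (t : tensor U V) :
  linear g -> g (tsum F t) = tsum (fun u v => g (F u v)) t.
Proof. exact: linear_big. Qed.

Lemma tsum_linear_fun (K : fieldType) (U V X W : lmodType K)
    (F : X -> U -> V -> W) (t : tensor U V) :
  (forall u v, linear (fun x => F x u v)) -> linear (fun x => tsum (F x) t).
Proof.
move=> F_linear c x y; rewrite /tsum scaler_sumr -big_split.
by apply: eq_bigr => p _; rewrite F_linear.
Qed.

(** Coassociativity in Sweedler form: a trilinear [F] induces a linear map on the triple tensor
    product, which is applied to both sides of [coprodA]. *)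
Lemma sweedlerA (K : fieldType) (C : coalgType K) (W : lmodType K)
    (F : C -> C -> C -> W) (h : C) :
  (forall v w, linear (fun u => F u v w)) ->
  (forall u w, linear (fun v => F u v w)) ->
  (forall u v, linear (F u v)) ->
  sweedler h (fun x w => sweedler x (fun u v => F u v w)) =
  sweedler h (fun u x => sweedler x (F u)).
Proof.
move=> F1 F2 F3.
have F23 u : bilinear_for *:%R *:%R (F u) by split=> ? ? ? ?; rewrite (F2, F3).
have F12 w : bilinear_for *:%R *:%R (fun u v => F u v w).
  by split=> ? ? ? ?; rewrite (F1, F2).
(* [tsum G] is that linear map: it sends [tens u (tens v w)] to [F u v w]. *)
pose G (u : C) (t : tensor C C) := tsum (F u) t.
have G_bil : bilinear_for *:%R *:%R G.
  split=> [t | u]; last exact: tsum_bilinear_linear.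
  exact: tsum_linear_fun.
have assoc_bil : bilinear_for *:%R *:%R
    (fun s (w : C) => tsum (fun u v : C => tens u (tens v w)) s).
  split=> [w | s].
    apply: tsum_bilinear_linear; split=> ? ? ? ?; last by rewrite linearPl linearPr.
    by rewrite linearPl.
  by apply: tsum_linear_fun => u v c x y; rewrite !linearPr.
have G_lin : linear (tsum G) by apply: tsum_bilinear_linear.
have assoc_lin : linear (@tassoc K C C C) by apply: tsum_bilinear_linear.
have := congr1 (tsum G) (coprodA h); rewrite /tmap.
rewrite (linear_tsum _ _ assoc_lin) !(linear_tsum _ _ G_lin) /sweedler => E.
etransitivity; last etransitivity; [|exact: E|].
  apply: eq_tsum => x w; rewrite /tassoc tsum_bilinear_tens //.
  rewrite (linear_tsum _ _ G_lin); apply: eq_tsum => u v.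
  by rewrite tsum_bilinear_tens // /G tsum_bilinear_tens.
by apply: eq_tsum => u x; rewrite tsum_bilinear_tens.
Qed.

(** By [trD] and coassociativity the right side is the sum of
    [tr h1 x ** tr (h2 * antipode h3 * k) y]. The antipode axiom turns [h2 * antipode h3] into a
    counit, which is then absorbed into [h1]. *)
Lemma module_algebra_mul (K : fieldType) (H : hopfAlgType K) (B : nuAlgType K)
    (tr : {bilinear H -> B -> B}) (h k : H) (x y : B) :
  module_algebra tr ->
  tr h x ** tr k y =
  sweedler h (fun h1 h2 => tr h1 (x ** tr (antipode h2 * k) y)).
Proof.
move=> [tr1 trM trD].
under [RHS]eq_bigr => p _ do rewrite trD.
rewrite -[RHS]/(sweedler h (fun z w =>
  sweedler z (fun u v => tr u x ** tr v (tr (antipode w * k) y)))).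
rewrite sweedlerA => [|v w c u u'|u w c v v'|u v c w w']; first last.
- by rewrite linearP mulrDl -scalerAl linearPl !linearPr.
- by rewrite !(linearPl, linearPr).
- by rewrite !linearPl.
(* The left side reaches this middle form by the counit axiom, the right side by the antipode
   axiom. *)
transitivity (sweedler h (fun u z => tr u x ** tr (counit z *: k) y)).
  rewrite -{1}[h]counitr {1}/tsum !linear_sumlz.
  apply: eq_bigr => p _.
  by rewrite !linearZl_LR /= linearZr_LR.
apply: eq_bigr => p _; rewrite {1}/sweedler {1}/tsum -linear_sumr; congr (_ ** _).
under eq_bigr => q _ do rewrite -trM mulrA.
rewrite -linear_sumlz; congr (tr _ y).
by rewrite -mulr_suml [X in X * k](antipoder p.2) mulr_algl.
Qed.

Section Span.
Variables (K : fieldType) (H : hopfAlgType K) (A B : nuAlgType K).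
Variables (act : {bilinear H -> A -> A}) (tr : {bilinear H -> B -> B}).
Variable theta : {numorphism A -> B}.

(** Scalars are absorbed into the [H] entries. With lists, adding two expressions is
    concatenation. *)
Lemma globalization_span (b : B) : globalization act tr theta ->
  exists s : seq (H * A), \sum_(p <- s) tr p.1 (theta p.2) = b.
Proof.
move=> glob; have [n [c [h [a ->]]]] := glob_span glob b.
exists [seq (c i *: h i, a i) | i <- enum 'I_n].
by rewrite big_map big_enum; apply: eq_bigr => i _; rewrite linearZl_LR.
Qed.

(** In [module_algebra_mul], [glob_mulr] brings the inner product back into the image of [theta], so
    only generators [tr h1 (theta _)] remain. *)
Lemma globalization_mul (h k : H) (a b : A) : globalization act tr theta ->
  tr h (theta a) ** tr k (theta b) =
  sweedler h (fun h1 h2 => tr h1 (theta (a ** act (antipode h2 * k) b))).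
Proof.
move=> glob; rewrite (module_algebra_mul _ _ _ _ (glob_modalg glob)).
by apply: eq_tsum => u v; rewrite -(glob_mulr glob).
Qed.

Lemma globalization_relation (s : seq (H * A)) (k : H) :
  (forall a : A, rann a -> a = 0) \/ (forall a : A, lann a -> a = 0) ->
  globalization act tr theta ->
  \sum_(p <- s) tr p.1 (theta p.2) = 0 ->
  \sum_(p <- s) act (k * p.1) p.2 = 0.
Proof.
move=> ann0 glob s0; have [_ trM _] := glob_modalg glob.
have {}s0 : \sum_(p <- s) tr (k * p.1) (theta p.2) = 0.
  by under eq_bigr do rewrite trM; rewrite -linear_sumr s0 linear0r.
(* For [rann] the sum is multiplied by [b] on the left and [glob_mulr] applies; for [lann], on the
   right with [glob_mull]. *)
case: ann0 => ann0; apply: ann0 => b; apply: (glob_inj glob); rewrite linear0.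
  rewrite linear_sumr linear_sum /=; under eq_bigr do rewrite (glob_mulr glob).
  by rewrite -linear_sumr s0 linear0r.
rewrite linear_sumlz linear_sum /=; under eq_bigr do rewrite (glob_mull glob).
by rewrite -linear_sumlz s0 linear0l.
Qed.

Lemma minimal_globalization_relation (s : seq (H * A)) :
  minimal_globalization act tr theta ->
  (forall k : H, \sum_(p <- s) act (k * p.1) p.2 = 0) ->
  \sum_(p <- s) tr p.1 (theta p.2) = 0.
Proof.
move=> [_ glob_min] s0; rewrite big_tnth; apply: glob_min => k.
by rewrite -[RHS](s0 k) [RHS]big_tnth.
Qed.

End Span.

Theorem theorem43 (K : fieldType) (H : hopfAlgType K)
    (A A' B B' : nuAlgType K)
    (act : {bilinear H -> A -> A}) (act' : {bilinear H -> A' -> A'})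
    (tr : {bilinear H -> B -> B}) (tr' : {bilinear H -> B' -> B'})
    (theta : {numorphism A -> B}) (theta' : {numorphism A' -> B'})
    (alpha : {numorphism A' -> A})
    (act_sym : symmetrical_partial_action act)
    (act'_sym : symmetrical_partial_action act')
    (glob : globalization act tr theta)
    (glob' : globalization act' tr' theta')
    (ann0 : (forall a : A', rann a -> a = 0) \/ (forall a : A', lann a -> a = 0))
    (glob_min : minimal_globalization act tr theta)
    (alpha_morph : partial_action_morphism act' act alpha) :
  exists! Phi : B' -> B,
    module_algebra_morphism tr' tr Phi /\
    forall a : A', Phi (theta' a) = theta (alpha a).
Proof.
(* Lists stand for formal sums in [H] tensor [A']; [Phi] will be [ev] factored through the
   surjection [ev']. *)
pose ev' (s : seq (H * A')) := \sum_(p <- s) tr' p.1 (theta' p.2).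
pose ev (s : seq (H * A')) := \sum_(p <- s) tr p.1 (theta (alpha p.2)).
have evE s : ev s = \sum_(p <- [seq (p.1, alpha p.2) | p <- s]) tr p.1 (theta p.2).
  by rewrite big_map.
have ev0 s : ev' s = 0 -> ev s = 0.
  move=> s0; rewrite evE; apply: (minimal_globalization_relation glob_min) => k.
  rewrite big_map /=; under eq_bigr do rewrite -alpha_morph.
  by rewrite -linear_sum (globalization_relation k ann0 glob' s0) linear0.
(* Formal linear combinations; [c = -1] gives differences, which turns the kernel inclusion [ev0]
   into [ev_eq]. *)
pose comb (c : K) (s t : seq (H * A')) := [seq (c *: p.1, p.2) | p <- s] ++ t.
have combE' c s t : ev' (comb c s t) = c *: ev' s + ev' t.
  rewrite /ev' big_cat big_map scaler_sumr; congr (_ + _).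
  by apply: eq_bigr => p _; rewrite linearZl_LR.
have combE c s t : ev (comb c s t) = c *: ev s + ev t.
  rewrite /ev big_cat big_map scaler_sumr; congr (_ + _).
  by apply: eq_bigr => p _; rewrite linearZl_LR.
have ev_eq s t : ev' s = ev' t -> ev s = ev t.
  move=> st; apply/eqP; rewrite eq_sym -subr_eq0 addrC -scaleN1r -combE.
  by rewrite ev0 // combE' st scaleN1r addNr.
(* An arbitrary section of [ev']; by [ev_eq] the value of [Phi] does not depend on it. *)
have [rep repK] := choice (fun b => globalization_span b glob').
pose Phi b := ev (rep b).
have PhiE s : Phi (ev' s) = ev s by apply: ev_eq; apply: repK.
have Phi_lin : linear Phi.
  by move=> c x y; rewrite -{1}[x]repK -{1}[y]repK -/(ev' _) -combE' PhiE combE.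
have Phi_gen h a : Phi (tr' h (theta' a)) = tr h (theta (alpha a)).
  by have := PhiE [:: (h, a)]; rewrite /ev' /ev !big_seq1.
have [tr1 trM _] := glob_modalg glob; have [tr'1 tr'M _] := glob_modalg glob'.
have Phi_mul : {morph Phi : b c / b ** c}.
  move=> b c; rewrite -[b]repK -[c]repK.
  rewrite -/(ev' _) -/(ev' (rep c)) !PhiE /ev' /ev !linear_sumlz.
  rewrite (linear_big _ _ Phi_lin); apply: eq_bigr => p _.
  rewrite !linear_sumr (linear_big _ _ Phi_lin); apply: eq_bigr => q _ /=.
  (* On generators both products expand by the same formula, and [alpha] carries [act'] to [act]
     inside it. *)
  rewrite (globalization_mul _ _ _ _ glob') (globalization_mul _ _ _ _ glob).
  rewrite /sweedler (linear_tsum _ _ Phi_lin); apply: eq_tsum => u v.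
  by rewrite Phi_gen numorphM alpha_morph.
have Phi_act h b : Phi (tr' h b) = tr h (Phi b).
  rewrite -[b]repK -/(ev' _) PhiE /ev' /ev !linear_sumr (linear_big _ _ Phi_lin).
  by apply: eq_bigr => p _ /=; rewrite -tr'M Phi_gen trM.
exists Phi; split.
  split; first by split.
  by move=> a; rewrite -[theta' a]tr'1 Phi_gen tr1.
(* Linearity, [H]-equivariance and the values on [theta'] already fix [Psi] on the spanning elements
   [tr' h (theta' a)]. *)
move=> Psi [[Psi_lin _ Psi_act] Psi_theta]; apply/funext => b.
rewrite -[b]repK -/(ev' _) PhiE /ev (linear_big _ _ Psi_lin).
by apply: eq_bigr => p _ /=; rewrite Psi_act Psi_theta.
Qed.
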